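(* Let $\alpha\ge 0$, $N\ge 1$, and let $a_1,\dots,a_N\in\mathbb{R}\setminus\{0\}$ satisfy the non neutral clusters hypothesis $$\forall P\subseteq\{1,\dots,N\}\text{ with }P\neq\emptyset,\qquad \sum_{i\in P}a_i\neq 0.$$ Then there exists a constant $C$, depending only on $N$, $\alpha$ and the intensities $a_i$, such that the following holds. Let $0<T<+\infty$ and let $X\in\mathbb{R}^{2N}$ be an initial datum such that the associated solution $t\mapsto (x_1(t),\dots,x_N(t))$ of the $\alpha$-point-vortex system with intensities $a_i$ is well defined on $[0,T)$. Then for all $i\in\{1,\dots,N\}$, $$\forall\, t_1<t_2\in[0,T),\qquad |t_2-t_1|\le 1\ \Longrightarrow\ |x_i(t_2)-x_i(t_1)|\le C\,|t_2-t_1|^{\frac{1}{\alpha+1}}.$$ In particular, each trajectory $x_i(t)$ converges as $t\to T^-$.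
   Context: For $x=(x_1,x_2)\in\mathbb{R}^2$, $x^\perp:=(-x_2,x_1)$. The $\alpha$-point-vortex system in the plane with intensities $a_1,\dots,a_N$ is the system of ODEs for $x_1(t),\dots,x_N(t)\in\mathbb{R}^2$: $$\frac{\mathrm d}{\mathrm dt}x_i(t)=\sum_{j\neq i}a_j\,\frac{(x_i(t)-x_j(t))^\perp}{|x_i(t)-x_j(t)|^{\alpha+1}},\qquad i=1,\dots,N.$$ The dynamics is well defined on $[0,T)$ if the solution exists on $[0,T)$ with no collapse there, i.e. $x_i(t)\ne x_j(t)$ for all $i\neq j$ and $t\in[0,T)$. *)

(* Defs.v *)
From HB Require Import structures.
From mathcomp Require Import all_boot all_order all_algebra.
From mathcomp Require Import all_classical all_reals all_analysis.

Set Implicit Arguments.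
Unset Strict Implicit.
Unset Printing Implicit Defensive.

Import Order.TTheory GRing.Theory Num.Theory.
Import numFieldNormedType.Exports.

Local Open Scope classical_set_scope.
Local Open Scope ring_scope.

(* The norm `|u| of the library on row vectors is the sup norm, hence this
   separate Euclidean norm. *)
Definition enorm (R : realType) (u : 'rV[R]_2) : R :=
  Num.sqrt (u 0 0 ^+ 2 + u 0 1 ^+ 2).

Definition perp (R : realType) (u : 'rV[R]_2) : 'rV[R]_2 :=
  \row_(k < 2) (if k == 0 then - u 0 1 else u 0 0).

Definition velocity (R : realType) (N : nat) (alpha : R) (a : 'I_N -> R)
    (y : 'I_N -> 'rV[R]_2) (i : 'I_N) : 'rV[R]_2 :=
  \sum_(j < N | j != i)
    (a j / enorm (y i - y j) `^ (alpha + 1)) *: perp (y i - y j).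

(* Trajectories are functions on all of R, but only their values on [0, T[
   matter.  At t = 0 the derivative is the right derivative. *)
Record vortex_solution (R : realType) (N : nat) (alpha : R) (a : 'I_N -> R)
    (X : 'I_N -> 'rV[R]_2) (T : R) (x : 'I_N -> R -> 'rV[R]_2) : Prop :=
  VortexSolution {
    vortex_init : forall i, x i 0 = X i;
    vortex_no_collapse : forall (i j : 'I_N) (t : R), i != j -> 0 <= t -> t < T ->
      x i t <> x j t;
    vortex_ode : forall (i : 'I_N) (t : R), 0 < t -> t < T ->
      is_derive t 1 (x i) (velocity alpha a (x^~ t) i);
    vortex_ode0 : forall i,
      h^-1 *: (x i h - x i 0) @[h --> 0^'+] --> velocity alpha a (x^~ 0) i
  }.

Definition non_neutral_clusters (R : realType) (N : nat) (a : 'I_N -> R) : Prop :=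
  forall P : {set 'I_N}, P != finset.set0 -> \sum_(i in P) a i != 0.

(* Main.v *)
Require Import Defs.
From HB Require Import structures.
From mathcomp Require Import all_boot all_order all_algebra.
From mathcomp Require Import all_classical all_reals all_analysis.
From mathcomp Require Import ring lra.

Set Implicit Arguments.
Unset Strict Implicit.
Unset Printing Implicit Defensive.

Import Order.TTheory GRing.Theory Num.Theory.
Import numFieldNormedType.Exports.

Local Open Scope classical_set_scope.
Local Open Scope ring_scope.

(** The system is invariant under the scaling of lengths by [L] and of times by
    [L ^ (alpha + 1)], so the Hölder bound says that in a time [L ^ (alpha + 1)]
    no vortex moves by more than a constant times [L].  This is proved by
    induction on the number of vortices, for clusters [P] that feel, besides
    their own interactions, an external velocity field of size at most
    [M / L ^ alpha] ([cluster_increment]).  That is the field that vortices at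
    distance at least [L] produce, which makes the induction close.

    Since the interaction is odd, only the external field moves the weighted
    sum of the positions of a cluster, and so by at most a constant times [L]
    ([barycentre_increment_le]).  As long as the diameter of the cluster is at
    most a large multiple of [L], each vortex stays that close to the barycentre
    (which exists because the total intensity of the cluster is nonzero) and its
    displacement is under control ([increment_bounded_diameter]).  At the first
    time the diameter becomes larger, if any, the cluster falls into two
    nonempty parts at a mutual distance of a large multiple of [L]
    ([separated_subset]).  Each part is then a smaller cluster whose external
    field has grown by at most a constant over [L ^ alpha].  The induction
    hypothesis bounds the displacements by a multiple of [L] smaller than the
    separation, so by a continuity argument the two parts remain separated until
    the final time ([increment_separated_clusters]).

    All vortices together form a cluster with no external field, and
    [L = (t2 - t1) ^ (1 / (alpha + 1))] gives the theorem.  Displacements are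
    measured in the sup norm, which is at most the Euclidean one and at least
    half of it. *)

(** * The sup norm, the Euclidean norm and the interaction kernel *)

Lemma norm_rV_le (R : realType) (n : nat) (u : 'rV[R]_n) (c : R) :
  0 <= c -> (forall k, `|u 0 k| <= c) -> `|u| <= c.
Proof.
move=> c0 uc; rewrite /Num.norm /= mx_normrE; apply: bigmax_le => // -[i k] _.
by rewrite /= (ord1 i).
Qed.

Lemma norm_coord_le (R : realType) (n : nat) (u : 'rV[R]_n) (k : 'I_n) :
  `|u 0 k| <= `|u|.
Proof.
rewrite [leRHS]/Num.norm /= mx_normrE.
exact: (le_bigmax_cond _ (fun i : 'I_1 * 'I_n => `|u i.1 i.2|) (j := (0, k))).
Qed.

Lemma norm_le_enorm (R : realType) (u : 'rV[R]_2) : `|u| <= enorm u.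
Proof.
apply: norm_rV_le => [|k]; first exact: sqrtr_ge0.
rewrite /enorm -sqrtr_sqr ler_wsqrtr //.
have [->|->] : k = 0 \/ k = 1 by case: k => -[|[|//]] ?; [left|right]; exact: val_inj.
- by rewrite lerDl sqr_ge0.
- by rewrite lerDr sqr_ge0.
Qed.

Lemma enorm_le_norm (R : realType) (u : 'rV[R]_2) : enorm u <= 2 * `|u|.
Proof.
rewrite /enorm -[leRHS]ger0_norm ?mulr_ge0 // -sqrtr_sqr ler_wsqrtr //.
have h k : u 0 k ^+ 2 <= `|u| ^+ 2.
  by rewrite -real_normK ?num_real // lerXn2r ?nnegrE ?norm_coord_le.
have := h 0; have := h 1; have := sqr_ge0 `|u|; lra.
Qed.

Lemma norm_perp_le (R : realType) (u : 'rV[R]_2) : `|perp u| <= `|u|.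
Proof.
by apply: norm_rV_le => // k; rewrite mxE; case: ifP => _; rewrite ?normrN norm_coord_le.
Qed.

Definition vortex_kernel (R : realType) (alpha : R) (u : 'rV[R]_2) : 'rV[R]_2 :=
  (enorm u `^ (alpha + 1))^-1 *: perp u.

Lemma vortex_kernelN (R : realType) (alpha : R) (u : 'rV[R]_2) :
  vortex_kernel alpha (- u) = - vortex_kernel alpha u.
Proof.
rewrite /vortex_kernel -scalerN /enorm !mxE !sqrrN; congr (_ *: _).
by apply/rowP => k; rewrite !mxE; case: ifP.
Qed.

Lemma vortex_kernel0 (R : realType) (alpha : R) : vortex_kernel alpha 0 = 0 :> 'rV[R]_2.
Proof.
by rewrite /vortex_kernel; apply/rowP => k; rewrite !mxE; case: ifP; rewrite ?oppr0 mulr0.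
Qed.

(** Rotation by a right angle preserves lengths, so the kernel has size
    [enorm u `^ (- alpha)], which is nonincreasing in [enorm u]. *)
Lemma norm_vortex_kernel_le (R : realType) (alpha L : R) (u : 'rV[R]_2) :
  0 <= alpha -> 0 < L -> L <= `|u| -> `|vortex_kernel alpha u| <= (L `^ alpha)^-1.
Proof.
move=> alpha0 L0 Lu; have Le := le_trans Lu (norm_le_enorm u).
have e0 : 0 < enorm u by exact: lt_le_trans Le.
have ea0 : 0 < enorm u `^ alpha by exact: powR_gt0.
rewrite normrZ powRD; last by rewrite (gt_eqF e0) implybT.
rewrite powRr1 ?(ltW e0) // normfV (ger0_norm (mulr_ge0 (ltW ea0) (ltW e0))).
rewrite invfM -mulrA; apply: (@le_trans _ _ (enorm u `^ alpha)^-1).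
  rewrite ler_piMr ?invr_ge0 ?(ltW ea0) // ler_pdivrMl // mulr1.
  exact: le_trans (norm_perp_le u) (norm_le_enorm u).
by rewrite lef_pV2 ?posrE ?powR_gt0 // ge0_ler_powR ?nnegrE // ltW.
Qed.

(** The sum keeps the term [j = i], whose kernel [vortex_kernel alpha 0] is [0]:
    without the side condition the double sums over a cluster are symmetric. *)
Definition cluster_velocity (R : realType) (N : nat) (alpha : R) (a : 'I_N -> R)
    (P : {set 'I_N}) (y : 'I_N -> 'rV[R]_2) (i : 'I_N) : 'rV[R]_2 :=
  \sum_(j in P) a j *: vortex_kernel alpha (y i - y j).

Lemma velocityE (R : realType) (N : nat) (alpha : R) (a : 'I_N -> R)
    (y : 'I_N -> 'rV[R]_2) (i : 'I_N) :
  velocity alpha a y i = cluster_velocity alpha a [set: 'I_N] y i.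
Proof.
rewrite /cluster_velocity (bigD1 i) ?inE //= subrr vortex_kernel0 scaler0 add0r.
apply: eq_big => [j|j _]; first by rewrite inE.
by rewrite /vortex_kernel scalerA.
Qed.

(** The kernel is odd, so exchanging the two indices changes the sign of the
    double sum. *)
Lemma total_momentum_eq0 (R : realType) (N : nat) (alpha : R) (a : 'I_N -> R)
    (P : {set 'I_N}) (y : 'I_N -> 'rV[R]_2) :
  \sum_(i in P) a i *: cluster_velocity alpha a P y i = 0.
Proof.
set S := LHS; suff SN : S = - S.
  have : 2 *: S = 0 by rewrite scaler_nat mulr2n {2}SN subrr.
  by move/eqP; rewrite scaler_eq0 pnatr_eq0 /= => /eqP.
rewrite {1}/S; under eq_bigr do rewrite scaler_sumr.
rewrite exchange_big /= /S -sumrN; apply: eq_bigr => j jP.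
rewrite scaler_sumr -sumrN; apply: eq_bigr => i iP.
by rewrite -[y i - y j]opprB vortex_kernelN !scalerN !scalerA [a i * a j]mulrC.
Qed.

(** The set [Q] consists of the points reached from [i0] by steps of length at
    most [r].  It misses [j0], since a path without repetition has fewer than
    [#|T|] steps. *)
Lemma separated_subset (R : realType) (V : normedModType R) (T : finType)
    (y : T -> V) (r : R) (i0 j0 : T) :
  0 <= r -> #|T|%:R * r < `|y i0 - y j0| ->
  exists Q : {set T}, [/\ i0 \in Q, j0 \notin Q &
    forall i j, i \in Q -> j \notin Q -> r < `|y i - y j|].
Proof.
move=> r0 far; pose e := [rel i j | `|y i - y j| <= r].
have path_le p i : path e i p -> `|y i - y (last i p)| <= (size p)%:R * r.
  elim: p i => [|j p IH] i /=; first by rewrite subrr normr0 mul0r.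
  case/andP=> eij /IH jp; rewrite -(subrKA (y j)) (le_trans (ler_normD _ _)) //.
  by rewrite -nat1r mulrDl mul1r lerD.
exists (finset (connect e i0)); split; first by rewrite inE connect0.
- rewrite inE; apply/negP => /connectP[p /shortenP[q q_path q_uniq _] j0E].
  have /path_le := q_path; rewrite -j0E leNgt => /negP; apply.
  apply: le_lt_trans far; rewrite ler_wpM2r // ler_nat.
  by rewrite ltnW //; move/card_uniqP: q_uniq => /= <-; exact: max_card.
- move=> i j; rewrite !inE => i0i; apply: contraNlt => eij.
  exact: connect_trans i0i (connect1 eij).
Qed.

(** * Derivatives along trajectories and first passage times *)

(** In the sup norm the vector-valued mean value inequality follows from the
    scalar mean value theorem on each coordinate. *)
Lemma norm_increment_le (R : realType) (n : nat) (x : R -> 'rV[R]_n)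
    (t1 t2 m : R) :
  t1 <= t2 ->
  (forall t, t1 <= t <= t2 -> derivable x t 1 /\ `|'D_1 x t| <= m) ->
  `|x t2 - x t1| <= m * (t2 - t1).
Proof.
move=> t12 dx; have m0 : 0 <= m.
  by have [] := dx t1; rewrite ?lexx // => _; exact: le_trans.
apply: norm_rV_le => [|k]; first by rewrite mulr_ge0 // subr_ge0.
pose f t := x t 0 k; pose df t := 'D_1 x t 0 k.
have fd t : t \in `[t1, t2] -> is_derive t 1 f (df t).
  rewrite in_itv /= => /dx[xd _].
  have fd : derivable f t 1 by have /derivable_mxP := xd; exact.
  by apply: DeriveDef => //; rewrite /df derive_mx // mxE.
have f_cont : {within `[t1, t2], continuous f}.
  by apply: derivable_within_continuous => t /fd[].
have fd_oo t : t \in `]t1, t2[ -> is_derive t 1 f (df t).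
  by move/subset_itv_oo_cc; exact: fd.
have [c ct e] := MVT_segment t12 fd_oo f_cont.
rewrite !mxE -/(f t2) -/(f t1) e normrM (ger0_norm (x := t2 - t1)) ?subr_ge0 //.
rewrite ler_wpM2r ?subr_ge0 // (le_trans (norm_coord_le _ _)) //.
by move: ct; rewrite in_itv /= => /dx[].
Qed.

Lemma is_derive_weighted_sum (R : realType) (n : nat) (I : Type) (r : seq I)
    (P : pred I) (a : I -> R) (x : I -> R -> 'rV[R]_n) (t : R) :
  (forall i, P i -> derivable (x i) t 1) ->
  is_derive t 1 (fun s => \sum_(i <- r | P i) a i *: x i s)
    (\sum_(i <- r | P i) a i *: 'D_1 (x i) t).
Proof.
move=> xd; elim: r => [|i r IH].
  under [X in is_derive _ _ X _]funext do rewrite big_nil.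
  by rewrite big_nil; exact: is_derive_cst.
under [X in is_derive _ _ X _]funext do rewrite big_cons.
rewrite big_cons; case: ifP => // Pi.
have di : is_derive t 1 (x i) ('D_1 (x i) t) by apply/derivableP/xd.
exact: is_deriveD (is_deriveZ (a i) di) IH.
Qed.

Lemma continuous_sum (R : realType) (V : normedModType R) (T : topologicalType)
    (I : Type) (r : seq I) (P : pred I) (f : I -> T -> V) (t : T) :
  (forall i, P i -> {for t, continuous (f i)}) ->
  {for t, continuous (fun s => \sum_(i <- r | P i) f i s)}.
Proof. by move=> fc; apply: cvg_big => //; exact: add_continuous. Qed.

(** The point [s] is the first time at which [phi] reaches [c]; the second
    alternative occurs when [phi] is already above [c] at the initial time. *)
Lemma first_passage (R : realType) (phi : R -> R) (t1 t2 t0 c : R) :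
  (forall t, t1 <= t <= t2 -> {for t, continuous phi}) ->
  t1 <= t0 <= t2 -> c <= phi t0 ->
  exists s, [/\ t1 <= s <= t2, c <= phi s &
    (forall t, t1 <= t <= s -> phi t <= c) \/ s = t1].
Proof.
move=> phi_cont t0_in ct0; pose S := [set t | t1 <= t <= t2 /\ c <= phi t].
have S_inf : has_inf S.
  by split; [exists t0|exists t1 => t [/andP[]]].
have lbS := inf_lbound S_inf.2.
pose s := inf S; have s_in : t1 <= s <= t2.
  apply/andP; split; first by apply: lb_le_inf S_inf.1 _ => t [/andP[]].
  by apply: le_trans (lbS _ (conj t0_in ct0)) _; case/andP: t0_in.
have [s1 s2] := andP s_in.
have lt_s t : t1 <= t -> t < s -> phi t < c.
  move=> t1t ts; rewrite ltNge; apply/negP => ct; move: (ts); apply/negP.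
  by rewrite -leNgt; apply: lbS; split=> //; rewrite t1t (le_trans (ltW ts)).
have near_s := phi_cont s s_in.
exists s; split=> //.
- rewrite leNgt; apply/negP => /(cvgr_lt _ near_s) /nbhs_ballP[e /= e0 se].
  have [t [tS ct] ts] := inf_adherent e0 S_inf.
  have st : s <= t by apply: lbS; split.
  have : phi t < c.
    by apply: se; rewrite /ball /= ltr_norml; apply/andP; split;
      rewrite -/s in ts; lra.
  by rewrite ltNge ct.
- have [->|s_neq] := eqVneq s t1; [by right|left] => t /andP[t1t].
  rewrite le_eqVlt => /predU1P[->{t t1t}|/(lt_s _ t1t)/ltW //].
  rewrite leNgt; apply/negP => /(cvgr_gt _ near_s) /nbhs_ballP[e /= e0 se].
  have t1s : t1 < s by rewrite lt_neqAle eq_sym s_neq.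
  pose t := Num.max t1 (s - e / 2).
  have ts : t < s by rewrite gt_max t1s /=; lra.
  have tt1 : t1 <= t by rewrite le_max lexx.
  have te : s - e / 2 <= t by rewrite le_max lexx orbT.
  have : c < phi t by apply: se; rewrite /ball /= ltr_norml; apply/andP; split; lra.
  by rewrite ltNge (ltW (lt_s _ tt1 ts)).
Qed.

(** * Clusters in an external field *)

(** The external field is not named: it is whatever remains of the velocity once
    the interactions inside the cluster are subtracted. *)
Definition perturbed_cluster (R : realType) (N : nat) (alpha : R)
    (a : 'I_N -> R) (P : {set 'I_N}) (x : 'I_N -> R -> 'rV[R]_2)
    (t1 t2 delta : R) : Prop :=
  forall i t, i \in P -> t1 <= t <= t2 -> derivable (x i) t 1 /\
    `|'D_1 (x i) t - cluster_velocity alpha a P (x^~ t) i| <= delta.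

Lemma perturbed_cluster_sub (R : realType) (N : nat) (alpha : R)
    (a : 'I_N -> R) (P : {set 'I_N}) (x : 'I_N -> R -> 'rV[R]_2)
    (t1 t2 s1 s2 delta : R) :
  t1 <= s1 -> s2 <= t2 -> perturbed_cluster alpha a P x t1 t2 delta ->
  perturbed_cluster alpha a P x s1 s2 delta.
Proof.
move=> ts1 ts2 xP i t iP /andP[st1 st2]; apply: xP => //.
by rewrite (le_trans ts1) //= (le_trans st2).
Qed.

Lemma continuous_perturbed_cluster (R : realType) (N : nat) (alpha : R)
    (a : 'I_N -> R) (P : {set 'I_N}) (x : 'I_N -> R -> 'rV[R]_2)
    (t1 t2 delta : R) (i : 'I_N) (t : R) :
  perturbed_cluster alpha a P x t1 t2 delta -> i \in P -> t1 <= t <= t2 ->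
  {for t, continuous (x i)}.
Proof.
move=> xP iP t12; have [xd _] := xP i t iP t12.
exact/differentiable_continuous/derivable1_diffP.
Qed.

Lemma norm_weighted_sum_le (R : realType) (V : normedModType R) (I : finType)
    (P : {pred I}) (a : I -> R) (v : I -> V) (c : R) :
  0 <= c -> (forall i, i \in P -> `|v i| <= c) ->
  `|\sum_(i in P) a i *: v i| <= (\sum_i `|a i|) * c.
Proof.
move=> c0 vc; rewrite mulr_suml (le_trans (ler_norm_sum _ _ _)) //.
rewrite big_mkcond /=; apply: ler_sum => i _; case: ifPn => [iP|_].
  by rewrite normrZ ler_wpM2l // vc.
by rewrite mulr_ge0.
Qed.

(** Interactions inside the cluster cancel in the weighted sum of the
    velocities, which leaves the external field alone. *)
Lemma barycentre_increment_le (R : realType) (N : nat) (alpha : R)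
    (a : 'I_N -> R) (P : {set 'I_N}) (x : 'I_N -> R -> 'rV[R]_2)
    (t1 t2 delta : R) :
  t1 <= t2 -> 0 <= delta -> perturbed_cluster alpha a P x t1 t2 delta ->
  `|\sum_(i in P) a i *: x i t2 - \sum_(i in P) a i *: x i t1|
    <= (\sum_i `|a i|) * delta * (t2 - t1).
Proof.
move=> t12 delta0 xP.
apply: (norm_increment_le (x := fun t => \sum_(i in P) a i *: x i t)) => // t tt.
have dB : is_derive t 1 (fun s => \sum_(i in P) a i *: x i s)
    (\sum_(i in P) a i *: 'D_1 (x i) t).
  by apply: is_derive_weighted_sum => i iP; have [] := xP i t iP tt.
have [Bd DB] := dB; split=> //; rewrite DB.
have -> : \sum_(i in P) a i *: 'D_1 (x i) t = \sum_(i in P)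
    a i *: ('D_1 (x i) t - cluster_velocity alpha a P (x^~ t) i).
  under [RHS]eq_bigr do rewrite scalerBr.
  by rewrite sumrB total_momentum_eq0 subr0.
by apply: norm_weighted_sum_le => // i iP; have [] := xP i t iP tt.
Qed.

(** Vortices of [P] outside [Q] become part of the external field of [Q]. *)
Lemma perturbed_subcluster (R : realType) (N : nat) (alpha : R)
    (a : 'I_N -> R) (P Q : {set 'I_N}) (x : 'I_N -> R -> 'rV[R]_2)
    (t1 t2 delta L : R) :
  0 <= alpha -> 0 < L -> Q \subset P ->
  (forall i j t, i \in Q -> j \in P :\: Q -> t1 <= t <= t2 ->
     L <= `|x i t - x j t|) ->
  perturbed_cluster alpha a P x t1 t2 delta ->
  perturbed_cluster alpha a Q x t1 t2
    (delta + (\sum_i `|a i|) * (L `^ alpha)^-1).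
Proof.
move=> alpha0 L0 QP sep xP i t iQ tt.
have [xd xv] := xP i t (fintype.subsetP QP i iQ) tt; split=> //.
have -> : 'D_1 (x i) t - cluster_velocity alpha a Q (x^~ t) i =
    ('D_1 (x i) t - cluster_velocity alpha a P (x^~ t) i) +
    \sum_(j in P :\: Q) a j *: vortex_kernel alpha (x i t - x j t).
  rewrite /cluster_velocity [in RHS](big_setID Q) /= (finset.setIidPr QP).
  by rewrite opprD addrA subrK.
rewrite (le_trans (ler_normD _ _)) // lerD //.
apply: norm_weighted_sum_le => [|j jPQ]; first by rewrite invr_ge0 powR_ge0.
by apply: norm_vortex_kernel_le => //; exact: sep.
Qed.

(** The vector [(\sum_j a j) *: x i] differs from the weighted sum of the
    positions by [\sum_j a j *: (x i - x j)], which the diameter bounds; the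
    weighted sum itself moves little. *)
Lemma increment_bounded_diameter (R : realType) (N : nat) (alpha : R)
    (a : 'I_N -> R) (P : {set 'I_N}) (x : 'I_N -> R -> 'rV[R]_2)
    (t1 t2 delta c : R) (i : 'I_N) :
  t1 <= t2 -> 0 <= delta -> 0 <= c -> perturbed_cluster alpha a P x t1 t2 delta ->
  (forall j, j \in P -> `|x i t1 - x j t1| <= c) ->
  (forall j, j \in P -> `|x i t2 - x j t2| <= c) ->
  `|\sum_(j in P) a j| * `|x i t2 - x i t1|
    <= (\sum_j `|a j|) * (c + c + delta * (t2 - t1)).
Proof.
move=> t12 delta0 c0 xP diam1 diam2; rewrite -normrZ.
have bary t : (\sum_(j in P) a j) *: x i t =
    \sum_(j in P) a j *: (x i t - x j t) + \sum_(j in P) a j *: x j t.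
  rewrite scaler_suml -big_split; apply: eq_bigr => j _ /=.
  by rewrite -scalerDr subrK.
rewrite scalerBr !bary opprD addrACA mulrDr (le_trans (ler_normD _ _)) //.
rewrite lerD //; last by rewrite mulrA (barycentre_increment_le t12 delta0 xP).
rewrite mulrDr (le_trans (ler_normB _ _)) //.
by rewrite lerD // norm_weighted_sum_le.
Qed.

(** * Splitting a cluster, and the induction on its size *)

Lemma sum_le_card (R : numDomainType) (I : finType) (P : {pred I})
    (F : I -> R) (c : R) :
  0 <= c -> (forall i, i \in P -> F i <= c) -> \sum_(i in P) F i <= #|I|%:R * c.
Proof.
move=> c0 Fc; rewrite big_mkcond /= mulr_natl.
by rewrite -sumr_const; apply: ler_sum => i _; case: ifPn => // /Fc.
Qed.

Lemma le_sum_nneg (R : numDomainType) (I : finType) (P : {pred I})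
    (F : I -> R) (i : I) :
  (forall j, 0 <= F j) -> i \in P -> F i <= \sum_(j in P) F j.
Proof. by move=> F0 iP; rewrite (bigD1 i) //= lerDl sumr_ge0. Qed.

(** Continuity argument: [psi], the total displacement since [t1], controls the
    separation of [Q] from the rest of [P] as long as it is at most
    [N%:R * C + L].  Up to the first time when it would reach that value, both
    parts are clusters with a slightly larger external field, hence each vortex
    has moved by at most [C] and [psi] is at most [N%:R * C]: the value is never
    reached. *)
Lemma increment_separated_clusters (R : realType) (N : nat) (alpha : R)
    (a : 'I_N -> R) (P Q : {set 'I_N}) (x : 'I_N -> R -> 'rV[R]_2)
    (t1 t2 delta L C : R) :
  0 <= alpha -> 0 < L -> 0 <= C -> t1 <= t2 -> Q \subset P ->
  perturbed_cluster alpha a P x t1 t2 delta ->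
  (forall Q' s, Q' = Q \/ Q' = P :\: Q -> t1 <= s <= t2 ->
     perturbed_cluster alpha a Q' x t1 s
       (delta + (\sum_i `|a i|) * (L `^ alpha)^-1) ->
     forall i, i \in Q' -> `|x i s - x i t1| <= C) ->
  (forall i j, i \in Q -> j \in P :\: Q ->
     L + 2 * (N%:R * C + L) <= `|x i t1 - x j t1|) ->
  forall i, i \in P -> `|x i t2 - x i t1| <= N%:R * C + L.
Proof.
move=> alpha0 L0 C0 t12 QP xP IH far i iP.
set c := N%:R * C + L; pose psi t := \sum_(j in P) `|x j t - x j t1|.
have le_psi j t : j \in P -> `|x j t - x j t1| <= psi t.
  by move=> jP; apply: (le_sum_nneg (F := fun j => `|x j t - x j t1|)).
have [psi2|psi2] := ltP (psi t2) c.
  exact: le_trans (le_psi i t2 iP) (ltW psi2).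
have psi_cont t : t1 <= t <= t2 -> {for t, continuous psi}.
  move=> tt; apply: continuous_sum => j jP; apply: cvg_norm.
  by apply: cvgB; [exact: continuous_perturbed_cluster xP jP tt|exact: cvg_cst].
have t2_in : t1 <= t2 <= t2 by rewrite t12 lexx.
have [s [/andP[t1s st2] psis psi_before]] := first_passage psi_cont t2_in psi2.
have psi_le t : t1 <= t <= s -> psi t <= c.
  case: psi_before => [|->]; first exact.
  move=> /le_anti <-; rewrite /psi big1 => [|j _]; last by rewrite subrr normr0.
  by rewrite addr_ge0 ?mulr_ge0 // ltW.
have sep j k t : j \in Q -> k \in P :\: Q -> t1 <= t <= s ->
    L <= `|x j t - x k t|.
  move=> jQ kPQ ts; have := far j k jQ kPQ.
  have jP := fintype.subsetP QP j jQ.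
  have kP : k \in P by case/finset.setDP: kPQ.
  have := le_psi j t jP; have := le_psi k t kP; have := psi_le t ts.
  have := ler_normD (x j t1 - x j t) (x j t - x k t1).
  have := ler_normD (x j t - x k t) (x k t - x k t1).
  rewrite !subrKA (distrC (x j t1) (x j t)) -/c; lra.
have xPs := perturbed_cluster_sub (lexx t1) st2 xP.
have s_in : t1 <= s <= t2 by rewrite t1s st2.
have psi_s j : j \in P -> `|x j s - x j t1| <= C.
  move=> jP; have [jQ|jQ] := boolP (j \in Q).
    by apply: (IH Q s) => //; [left|exact: perturbed_subcluster xPs].
  apply: (IH (P :\: Q) s) => //; [by right| |by rewrite inE jQ].
  apply: perturbed_subcluster xPs => //; first exact: finset.subsetDl.
  move=> k l t; rewrite finset.setDDr finset.setDv finset.set0U.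
  by rewrite (finset.setIidPr QP) => kPQ lQ ts; rewrite distrC; exact: sep.
have := sum_le_card C0 psi_s; rewrite card_ord -/(psi s) => psi_sC.
by move: psis; rewrite /c leNgt => /negP; case; apply: le_lt_trans psi_sC _; rewrite ltrDl.
Qed.

(** The constants are chosen in the order of dependence: [C'] comes from the
    induction hypothesis, [c2 * L] bounds the displacement after a splitting,
    [r * L] is the separation that such a displacement cannot destroy, and
    [c1 * L] is a value of the sum [phi] of mutual distances which forces two
    vortices to be far enough apart for a splitting at scale [r * L].  [D]
    bounds the inverse of the total intensity of every nonempty cluster. *)
Lemma cluster_increment (R : realType) (N : nat) (alpha : R) (a : 'I_N -> R)
    (k : nat) (M : R) :
  0 <= alpha -> non_neutral_clusters a -> 0 <= M ->
  exists2 C : R, 0 <= C & forall (P : {set 'I_N}) (x : 'I_N -> R -> 'rV[R]_2)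
      (L t1 t2 : R),
    (#|P| <= k)%N -> 0 < L -> t1 <= t2 -> t2 - t1 <= L `^ (alpha + 1) ->
    perturbed_cluster alpha a P x t1 t2 (M * (L `^ alpha)^-1) ->
    forall i, i \in P -> `|x i t2 - x i t1| <= C * L.
Proof.
move=> alpha0 nnc; elim: k M => [|k IH] M M0.
  exists 0 => // P x L t1 t2; rewrite leqn0 cards_eq0 => /eqP-> _ _ _ _ i.
  by rewrite inE.
pose A := \sum_i `|a i|; have A0 : 0 <= A by rewrite sumr_ge0.
pose D := \sum_(P : {set 'I_N}) `|\sum_(i in P) a i|^-1.
have D0 : 0 <= D by rewrite sumr_ge0 // => P _; rewrite invr_ge0.
have [C' C'0 {}IH] := IH (M + A) (addr_ge0 M0 A0).
pose c2 := N%:R * C' + 1; have c20 : 0 <= c2 by rewrite addr_ge0 ?mulr_ge0.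
pose r := 1 + 2 * c2; have r0 : 0 <= r by rewrite addr_ge0 ?mulr_ge0.
pose c1 := N%:R * (N%:R * (N%:R * r)) + 1.
have c10 : 0 <= c1 by rewrite addr_ge0 ?mulr_ge0.
pose C1 := D * (A * (c1 + c1 + M)).
have C10 : 0 <= C1 by rewrite !(mulr_ge0, addr_ge0).
exists (C1 + c2); first exact: addr_ge0.
move=> P x L t1 t2 Pk L0 t12 short xP i iP; rewrite mulrDl.
have La0 : 0 < L `^ alpha by exact: powR_gt0.
have delta0 : 0 <= M * (L `^ alpha)^-1 by rewrite mulr_ge0 ?invr_ge0 ?(ltW La0).
have LE : (L `^ alpha)^-1 * L `^ (alpha + 1) = L.
  rewrite powRD ?(gt_eqF L0) ?implybT // powRr1 ?(ltW L0) // mulrA.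
  by rewrite mulVf ?mul1r ?gt_eqF.
pose phi t := \sum_(j in P) \sum_(l in P) `|x j t - x l t|.
have le_phi j l t : j \in P -> l \in P -> `|x j t - x l t| <= phi t.
  move=> jP lP; have := le_sum_nneg (F := fun l => `|x j t - x l t|) _ lP.
  move=> /(_ (fun=> normr_ge0 _))/le_trans; apply.
  apply: (le_sum_nneg (F := fun j => \sum_(l in P) `|x j t - x l t|)) => // m.
  by rewrite sumr_ge0.
have phi_cont t : t1 <= t <= t2 -> {for t, continuous phi}.
  move=> tt; do 2![apply: continuous_sum => ? ?]; apply: cvg_norm.
  by apply: cvgB; apply: continuous_perturbed_cluster xP _ tt.
(* Moderate diameter up to [s]: compare each vortex with the barycentre. *)
have bounded s : t1 <= s <= t2 -> phi t1 <= c1 * L -> phi s <= c1 * L ->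
    forall j, j \in P -> `|x j s - x j t1| <= C1 * L.
  move=> /andP[t1s st2] phi1 phis j jP.
  have P0 : P != finset.set0 by apply/set0Pn; exists j.
  have aP0 : 0 < `|\sum_(l in P) a l| by rewrite normr_gt0 nnc.
  have diam t l : phi t <= c1 * L -> l \in P -> `|x j t - x l t| <= c1 * L.
    by move=> phit lP; apply: le_trans phit; exact: le_phi.
  have c1L0 : 0 <= c1 * L by rewrite mulr_ge0 ?(ltW L0).
  have := increment_bounded_diameter t1s delta0 c1L0
    (perturbed_cluster_sub (lexx t1) st2 xP) (diam t1 ^~ phi1) (diam s ^~ phis).
  rewrite -ler_pdivlMl // => /le_trans; apply.
  rewrite /C1 -[leRHS]mulrA; apply: ler_pM.
  - by rewrite invr_ge0.
  - apply: mulr_ge0 => //; apply: addr_ge0; first exact: addr_ge0.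
    by apply: mulr_ge0 => //; rewrite subr_ge0.
  - pose F (Q : {set 'I_N}) := `|\sum_(l in Q) a l|^-1.
    by apply: (le_sum_nneg (P := predT) (F := F)) => // Q; rewrite invr_ge0.
  - rewrite -/A -[leRHS]mulrA; apply: ler_wpM2l => //.
    rewrite !(mulrDl _ _ L) lerD // -[leLHS]mulrA; apply: ler_wpM2l => //.
    rewrite -[leRHS]LE; apply: ler_wpM2l; first by rewrite invr_ge0 ltW.
    by apply: le_trans short; rewrite lerD2r.
(* The motion is cut at the first time when the cluster spreads out. *)
have [phi_big|phi_small] := pselect
    (exists2 t, t1 <= t <= t2 & c1 * L <= phi t); last first.
  have phi_le t : t1 <= t <= t2 -> phi t <= c1 * L.
    by move=> tt; rewrite leNgt; apply/negP => /ltW ?; apply: phi_small; exists t.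
  rewrite ler_wpDr ?mulr_ge0 ?(ltW L0) // bounded ?phi_le ?lexx ?t12 //.
case: phi_big => t0 t0_in phi0.
have [s [/andP[t1s st2] phis phi_before]] := first_passage phi_cont t0_in phi0.
rewrite -(subrKA (x i s)) addrC (le_trans (ler_normD _ _)) // lerD //.
  case: phi_before => [phi_le|->]; last first.
    by rewrite subrr normr0 mulr_ge0 // ltW.
  by apply: bounded => //; rewrite ?phi_le ?t1s ?lexx.
(* If all distances were below the threshold, [phi s] would be less than [c1 * L]. *)
have [j [l [jP lP jl_far]]] : exists j l,
    [/\ j \in P, l \in P & N%:R * (r * L) < `|x j s - x l s|].
  apply: contrapT => near; have rL0 : 0 <= N%:R * (r * L).
    by rewrite !mulr_ge0 ?(ltW L0).
  have : phi s <= N%:R * (N%:R * (N%:R * (r * L))).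
    rewrite -[X in X%:R * (X%:R * _)]card_ord; apply: sum_le_card => [|j jP].
      by rewrite mulr_ge0.
    apply: sum_le_card => // l lP; rewrite leNgt; apply/negP => jl.
    by apply: near; exists j, l.
  apply/negP; rewrite -ltNge; apply: lt_le_trans phis.
  by rewrite /c1 (mulrDl _ 1) mul1r !mulrA ltrDl.
have rL0 : 0 <= r * L by rewrite mulr_ge0 ?(ltW L0).
rewrite -[N in N%:R * (r * L) < _]card_ord in jl_far.
have [Q0 [jQ0 lQ0 sep]] := separated_subset (y := x^~ s) rL0 jl_far.
pose Q := P :&: Q0; have QP : Q \subset P by exact: finset.subsetIl.
have c2L : N%:R * (C' * L) + L = c2 * L by rewrite /c2 mulrDl mul1r mulrA.
have C'L0 : 0 <= C' * L by rewrite mulr_ge0 ?(ltW L0).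
have xPs := perturbed_cluster_sub t1s (lexx t2) xP.
rewrite -c2L; apply: (increment_separated_clusters alpha0 L0 C'L0 st2 QP xPs) => //.
- move=> Q' s' Q'E /andP[ss' s't2] xQ'.
  apply: IH => //.
  + rewrite -ltnS; apply: leq_trans Pk; apply: proper_card.
    apply/properP; case: Q'E => ->.
      by split=> //; exists l => //; rewrite inE (negPf lQ0) andbF.
    split; first exact: finset.subsetDl.
    by exists j => //; rewrite !inE jQ0 jP.
  + by apply: le_trans short; rewrite lerB.
  + by rewrite mulrDl.
- move=> m p; rewrite !inE => /andP[mP mQ0] /andP[pQ pP].
  rewrite pP /= in pQ; rewrite c2L; apply: le_trans (ltW (sep m p mQ0 pQ)).
  by rewrite /r [leRHS]mulrDl mul1r mulrA.
Qed.

(** * From increments to Hölder continuity and convergence *)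

Lemma cvg_right_quotient (R : realType) (V : normedModType R) (f : R -> V)
    (t0 : R) (l : V) :
  h^-1 *: (f (t0 + h) - f t0) @[h --> 0^'+] --> l ->
  f (t0 + h) @[h --> 0^'+] --> f t0.
Proof.
move=> quot; have h0 : (h : R) @[h --> 0^'+] --> (0 : R).
  by apply: cvg_at_right_filter; exact: cvg_id.
have lim : h *: (h^-1 *: (f (t0 + h) - f t0)) + f t0 @[h --> 0^'+]
    --> 0 *: l + f t0.
  by apply: cvgD; [exact: cvgZ|exact: cvg_cst].
rewrite scale0r add0r in lim; apply: cvg_trans lim; apply: near_eq_cvg.
near=> h; have h_gt0 : 0 < h by near: h; exact: nbhs_right_gt.
by rewrite /= scalerA divff ?gt_eqF // scale1r subrK.
Unshelve. all: by end_near. Qed.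

(** A Hölder bound makes the trajectory Cauchy at the left of [T]. *)
Lemma cvg_left_holder (R : realType) (n : nat) (f : R -> 'rV[R]_n)
    (t0 T C beta : R) :
  0 < beta -> t0 < T ->
  (forall t1 t2, t0 < t1 -> t1 < t2 -> t2 < T ->
     `|f t2 - f t1| <= C * (t2 - t1) `^ beta) ->
  exists l : 'rV[R]_n, f t @[t --> T^'-] --> l.
Proof.
move=> beta0 t0T holder; suff : cvg (f t @[t --> T^'-]).
  by move=> fT; exists (lim (f t @[t --> T^'-])).
apply: cauchy_cvg; apply: cauchy_exP => e e0.
pose C' := `|C| + 1; have C'0 : 0 < C' by rewrite ltr_wpDl.
(* Chosen so that [C' * d `^ beta = e]. *)
pose d := (e / C') `^ beta^-1.
have d0 : 0 < d by rewrite powR_gt0 // divr_gt0.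
pose t1 := Num.max ((t0 + T) / 2) (T - d / 2).
have t1T : t1 < T by rewrite gt_max; apply/andP; split; lra.
have t01 : t0 < t1 by rewrite lt_max; apply/orP; left; lra.
have t1d : T - d / 2 <= t1 by rewrite le_max lexx orbT.
exists (f t1).
suff ball_t : \forall t \near T^'-, ball (f t1) e (f t) by exact: ball_t.
near=> t.
have t1t : t1 < t by near: t; exact: nbhs_left_gt.
have tT : t < T by near: t; exact: nbhs_left_lt.
rewrite /= -ball_normE /= distrC (le_lt_trans (holder _ _ t01 t1t tT)) //.
have dt : (t - t1) `^ beta < e / C'.
  have -> : e / C' = d `^ beta.
    by rewrite -powRrM mulVf ?gt_eqF // powRr1 // ltW // divr_gt0.
  by rewrite gt0_ltr_powR ?nnegrE //; lra.
apply: (@le_lt_trans _ _ (C' * (t - t1) `^ beta)).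
  by rewrite ler_wpM2r ?powR_ge0 // (le_trans (ler_norm C)) // lerDl.
by rewrite -ltr_pdivlMl // mulrC.
Unshelve. all: by end_near. Qed.

Theorem theorem1p1 (R : realType) (alpha : R) (N : nat) (a : 'I_N -> R)
    (alpha_ge0 : 0 <= alpha) (N_ge1 : (1 <= N)%N)
    (a_neq0 : forall i, a i != 0) (nnc : non_neutral_clusters a) :
  exists C : R, forall (T : R) (X : 'I_N -> 'rV[R]_2) (x : 'I_N -> R -> 'rV[R]_2),
    0 < T -> vortex_solution alpha a X T x ->
    forall i : 'I_N,
      (forall t1 t2 : R, 0 <= t1 -> t1 < t2 -> t2 < T -> `|t2 - t1| <= 1 ->
         enorm (x i t2 - x i t1) <= C * `|t2 - t1| `^ (1 / (alpha + 1))) /\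
      (exists l : 'rV[R]_2, x i t @[t --> T^'-] --> l).
Proof.
have [C C0 cluster] := cluster_increment N alpha_ge0 nnc (lexx 0).
exists (2 * C) => T X x T0 [_ _ ode ode0] i.
set beta := 1 / (alpha + 1).
have alpha1 : 0 < alpha + 1 by rewrite ltr_wpDl.
have beta0 : 0 < beta by rewrite divr_gt0.
have interior t1 t2 : 0 < t1 -> t1 < t2 -> t2 < T ->
    `|x i t2 - x i t1| <= C * (t2 - t1) `^ beta.
  move=> t1_gt0 t12 t2T; have t12_gt0 : 0 < t2 - t1 by rewrite subr_gt0.
  apply: (cluster finset.setT) => //.
  - by rewrite cardsT card_ord.
  - exact: powR_gt0.
  - exact: ltW.
  - by rewrite -powRrM /beta div1r mulVf ?gt_eqF // powRr1 // ltW.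
  - move=> j t _ /andP[t1t tt2].
    have [xd Dx] := ode j t (lt_le_trans t1_gt0 t1t) (le_lt_trans tt2 t2T).
    by split=> //; rewrite Dx velocityE subrr normr0 mul0r.
split; last exact: cvg_left_holder beta0 T0 interior.
move=> t1 t2 t1_ge0 t12 t2T _; have t12_gt0 : 0 < t2 - t1 by rewrite subr_gt0.
rewrite (gtr0_norm t12_gt0) (le_trans (enorm_le_norm _)) // -mulrA ler_wpM2l //.
move: t1_ge0; rewrite le_eqVlt => /predU1P[t1_0|t1_gt0]; last exact: interior.
(* At the initial time only a right derivative exists, so the bound is
   obtained there by letting the earlier time tend to [0] from the right. *)
subst t1; rewrite subr0 in t12_gt0 *.
have x_right : x i h @[h --> 0^'+] --> x i 0.
  have : h^-1 *: (x i (0 + h) - x i 0) @[h --> 0^'+] --> velocity alpha a (x^~ 0) i.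
    by under eq_fun do rewrite add0r; exact: ode0.
  by move/cvg_right_quotient; under eq_fun do rewrite add0r.
have incr_cvg : `|x i t2 - x i h| @[h --> 0^'+] --> `|x i t2 - x i 0|.
  by apply: cvg_norm; apply: cvgB => //; exact: cvg_cst.
apply: (cvgr_to_le incr_cvg); near=> h.
have h_gt0 : 0 < h by near: h; exact: nbhs_right_gt.
have ht2 : h < t2 by near: h; exact: nbhs_right_lt.
rewrite (le_trans (interior h t2 h_gt0 ht2 t2T)) // ler_wpM2l //.
by rewrite ge0_ler_powR ?nnegrE ?(ltW beta0) ?(ltW t12_gt0) //; lra.
Unshelve. all: by end_near. Qed.
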